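(* The function $$q\longmapsto F(q):=\frac{T(\Omega_q)}{q^2}$$ is strictly increasing on $(0,\infty)$. More precisely, if for $q>0$ $$A(q)=\int_{\Omega_q}(u_q)_x^2\,dx\,dy,\qquad B(q)=\int_{\Omega_q}(u_q)_y^2\,dx\,dy,$$ then for every $q>0$ $$\frac{d}{dq}\left(\frac{T(\Omega_q)}{q^2}\right)=\frac{A(q)-B(q)}{q^3}>0.$$
   Context: For $q>0$ let $\Omega_q=\{(x,y)\in\mathbb R^2:0<x<q,\ 0<y<1-x/q\}$ be the open right triangle with vertices $A=(0,0)$, $B_q=(q,0)$, $C=(0,1)$. Let $u_q$ be the (weak) solution of the mixed boundary value problem $$-\Delta u_q=1\ \text{in }\Omega_q,\qquad u_q=0\ \text{on the side }AC,\qquad \partial_\nu u_q=0\ \text{on the sides }AB_q\cup B_qC,$$ where $\nu$ is the outward unit normal. The mixed torsional rigidity is $T(\Omega_q)=\int_{\Omega_q}u_q\,dx\,dy$. Subscripts $x,y$ on $(u_q)$ denote partial derivatives. *)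

(* Defs.v *)
From HB Require Import structures.
From mathcomp Require Import all_boot all_order all_algebra.
From mathcomp Require Import all_classical all_reals all_analysis.

Set Implicit Arguments.
Unset Strict Implicit.
Unset Printing Implicit Defensive.

Import Order.TTheory GRing.Theory Num.Theory.
Import numFieldNormedType.Exports.

Local Open Scope classical_set_scope.
Local Open Scope ring_scope.

Notation leb2 := (lebesgue_measure \x lebesgue_measure)%E.

Section Plane.
Variable R : realType.

Definition e_x : R * R := (1, 0).
Definition e_y : R * R := (0, 1).

(* C^oo on the plane: every iterated directional derivative is (Frechet)
   differentiable. *)
Definition smooth (phi : R * R -> R) : Prop :=
  forall (s : seq (R * R)) (z : R * R),
    differentiable (foldr (fun v (g : R * R -> R) => 'D_v g) phi s) z.

(* C^oo_c(D) *)
Definition test_function (D : set (R * R)) (phi : R * R -> R) : Prop :=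
  [/\ smooth phi, compact (closure [set z | phi z != 0]) &
      closure [set z | phi z != 0] `<=` D].

Section L2.
Context {d : measure_display} {X : measurableType d}.
Variables (mu : {measure set X -> \bar R}) (D : set X).

(* Measurability refers to the Borel sigma-algebra on which lebesgue_measure is
   defined; every Lebesgue class has such a representative. *)
Definition in_L2 (f : X -> R) : Prop :=
  measurable_fun D f /\ (\int[mu]_(z in D) ((f z) ^+ 2)%:E < +oo)%E.

Definition cvg_L2 (f_ : nat -> X -> R) (f : X -> R) : Prop :=
  (\int[mu]_(z in D) ((f_ n z - f z) ^+ 2)%:E)%E @[n --> \oo] --> 0%E.

End L2.

(* g is the distributional derivative of f on D in the direction v *)
Definition weak_derivative (D : set (R * R)) (v : R * R) (f g : R * R -> R) :
    Prop :=
  forall phi, test_function D phi ->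
    \int[leb2]_(z in D) (f z * 'D_v phi z) =
    - \int[leb2]_(z in D) (g z * phi z).

(* u belongs to H^1(D) and its weak gradient is (ux, uy); as usual (ux, uy) is
   determined by u up to a Lebesgue-null set *)
Definition H1_grad (D : set (R * R)) (u ux uy : R * R -> R) : Prop :=
  [/\ in_L2 leb2 D u, in_L2 leb2 D ux, in_L2 leb2 D uy,
      weak_derivative D e_x u ux & weak_derivative D e_y u uy].

(* The open triangle with vertices A = (0, 0), B = (q, 0), C = (0, 1). *)
Definition triangle (q : R) : set (R * R) :=
  [set z | 0 < z.1 < q /\ 0 < z.2 < 1 - z.1 / q].

(* w is the trace on the side AC, parametrised by y in ]0, 1[, of the function u
   of H^1(triangle q) with weak gradient (ux, uy): the trace operator is the
   extension by continuity, from H^1 to L^2(AC), of the restriction to AC of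
   functions that are smooth up to the boundary (restrictions of C^oo functions
   on the plane). *)
Definition trace_AC (q : R) (u ux uy : R * R -> R) (w : R -> R) : Prop :=
  exists phi : nat -> R * R -> R,
    [/\ forall n, smooth (phi n),
        cvg_L2 leb2 (triangle q) phi u,
        cvg_L2 leb2 (triangle q) (fun n => 'D_e_x (phi n)) ux,
        cvg_L2 leb2 (triangle q) (fun n => 'D_e_y (phi n)) uy &
        cvg_L2 lebesgue_measure `]0, 1[ (fun n y => phi n (0, y)) w].

Definition H1_AC (q : R) (u ux uy : R * R -> R) : Prop :=
  H1_grad (triangle q) u ux uy /\ trace_AC q u ux uy (cst 0).

(* Weak form of -Delta u = 1 with u = 0 on AC; the homogeneous Neumann condition
   on AB and BC is the natural one, since test functions are free there. *)
Definition weak_solution (q : R) (u ux uy : R * R -> R) : Prop :=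
  H1_AC q u ux uy /\
  forall v vx vy, H1_AC q v vx vy ->
    \int[leb2]_(z in triangle q) (ux z * vx z + uy z * vy z) =
    \int[leb2]_(z in triangle q) v z.

End Plane.

(* Main.v *)
Require Import Defs.
From HB Require Import structures.
From mathcomp Require Import all_boot all_order all_algebra.
From mathcomp Require Import all_classical all_reals all_analysis.
From mathcomp Require Import measurable_realfun ring lra.
Import Order.TTheory GRing.Theory Num.Theory.
Import numFieldNormedType.Exports.
Local Open Scope classical_set_scope.
Local Open Scope ring_scope.

(** Let [u] solve the problem on the triangle of base [q], with torsion [T],
    horizontal energy [A] and vertical energy [B].

    _The sign._ Testing the equation with [u] itself gives [A + B = T], so
    [B < A] amounts to [T < 2 * A], and only [A] has to be compared with [T].
    Two elementary fields do it for every [q] at once.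
    - The function [x] is admissible, with gradient [(1, 0)].  Testing with it
      gives [\int u_x = \int x = q^2 / 6], and expanding
      [0 <= \int (u_x - q / 3)^2] yields [q^3 / 18 <= A] ([x_energy_ge]).
    - Let [sigma] be the horizontal distance to the hypotenuse.  The field
      [(sigma, 0)] has divergence [-1] and its flux through the base and through
      the hypotenuse is zero; as [u] vanishes on the remaining side,
      [T = \int sigma * u_x] ([Rintegral_H1_AC_sigma]).  Expanding
      [0 <= \int (sigma - u_x)^2] with [\int sigma^2 = q^3 / 12] yields
      [T <= q^3 / 24 + A / 2] ([torsion_le_x_energy]).
    Together, [T <= 5 / 4 * A < 2 * A].

    _The derivative._ Stretching horizontally by [q / p] maps the triangle of
    base [p] onto that of base [q] and carries admissible functions to
    admissible functions ([H1_AC_stretch]). Hence each of the two solutions,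
    once moved to the other triangle, is a test function for the other
    equation. The two resulting identities, [cross_energy_q] and
    [cross_energy_p], involve only the mixed energies [al] and [be] of the
    horizontal and of the vertical derivatives on the triangle of base [p],
    and they give exactly [F p - F q = (p - q) * (al - be) / (q * p^2)]
    ([torsion_ratio_diff]). They also show that the squared L2 distance
    between the two gradients is [(p - q)^2] times a bounded quantity, so that
    [al] and [be] converge to [A] and [B] as [p] tends to [q]
    ([cross_energy_bounds]). The difference quotients of [F] therefore
    converge to [(A - B) / q^3], and strict monotonicity follows from the mean
    value theorem. *)

Set Implicit Arguments.
Unset Strict Implicit.
Unset Printing Implicit Defensive.

(** * Square-integrable functions *)

Section SquareIntegrable.
Context {d : measure_display} {X : measurableType d} {R : realType}.
Variables (mu : {measure set X -> \bar R}) (D : set X).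
Hypothesis mD : measurable D.
Implicit Types f g h : X -> R.

Lemma integrable_EFinD f g :
  mu.-integrable D (EFin \o f) -> mu.-integrable D (EFin \o g) ->
  mu.-integrable D (EFin \o (fun z => f z + g z)).
Proof. exact: integrableD. Qed.

Lemma integrable_EFinZ c f : mu.-integrable D (EFin \o f) ->
  mu.-integrable D (EFin \o (fun z => c * f z)).
Proof. exact: (@integrableZl _ _ _ mu D mD c (EFin \o f)). Qed.

Lemma in_L2_integrable_mul f g : in_L2 mu D f -> in_L2 mu D g ->
  mu.-integrable D (EFin \o (fun z => f z * g z)).
Proof.
move=> [mf f2] [mg g2]; apply/integrableP; split.
  by apply/measurable_EFinP; exact: measurable_funM.
have mf2 : measurable_fun D (fun z => (f z ^+ 2)%:E).
  by apply/measurable_EFinP; exact: measurable_funX.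
have mg2 : measurable_fun D (fun z => (g z ^+ 2)%:E).
  by apply/measurable_EFinP; exact: measurable_funX.
apply: (@le_lt_trans _ _ (\int[mu]_(z in D) ((f z ^+ 2)%:E + (g z ^+ 2)%:E))%E).
  apply: ge0_le_integral => //=.
  - do 2 apply: measurableT_comp => //; exact: measurable_funM.
  - exact: emeasurable_funD.
  - move=> z _; rewrite -EFinD lee_fin normrM.
    have := sqr_ge0 (`|f z| - `|g z|).
    rewrite -(real_normK (num_real (f z))) -(real_normK (num_real (g z))).
    have := normr_ge0 (f z); have := normr_ge0 (g z); nra.
rewrite ge0_integralD//.
- exact: lte_add_pinfty.
- by move=> z _; rewrite lee_fin sqr_ge0.
- by move=> z _; rewrite lee_fin sqr_ge0.
Qed.

Lemma in_L2_integrable_sqr f : in_L2 mu D f ->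
  mu.-integrable D (EFin \o (fun z => f z ^+ 2)).
Proof.
move=> Lf.
rewrite (_ : (fun z => f z ^+ 2) = (fun z => f z * f z)).
  exact: in_L2_integrable_mul.
by apply/funext => z; rewrite expr2.
Qed.

Lemma in_L2_integrable_sqrP f :
  measurable_fun D f -> mu.-integrable D (EFin \o (fun z => f z ^+ 2)) ->
  in_L2 mu D f.
Proof.
move=> mf /integrableP[_ fi]; split => //.
by under eq_integral => z _ do
  rewrite -[(_ ^+ 2)%:E]gee0_abs ?lee_fin ?sqr_ge0//.
Qed.

Lemma in_L2D f g : in_L2 mu D f -> in_L2 mu D g ->
  in_L2 mu D (fun z => f z + g z).
Proof.
move=> Lf Lg; apply: in_L2_integrable_sqrP.
  by apply: measurable_funD; [case: Lf | case: Lg].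
have If := in_L2_integrable_sqr Lf; have Ig := in_L2_integrable_sqr Lg.
have Ifg := in_L2_integrable_mul Lf Lg.
rewrite (_ : (fun z => _) =
    fun z => (f z ^+ 2 + g z ^+ 2) + (f z * g z + f z * g z)); last first.
  by apply/funext => z; ring.
by do ?apply: integrable_EFinD.
Qed.

Lemma in_L2Z (c : R) f : in_L2 mu D f -> in_L2 mu D (fun z => c * f z).
Proof.
move=> Lf; apply: in_L2_integrable_sqrP.
  by apply: measurable_funM => //; case: Lf.
under [X in _ \o X]eq_fun do rewrite exprMn.
exact/integrable_EFinZ/in_L2_integrable_sqr.
Qed.

Lemma in_L2B f g : in_L2 mu D f -> in_L2 mu D g ->
  in_L2 mu D (fun z => f z - g z).
Proof.
move=> Lf Lg.
rewrite (_ : (fun z => _) = fun z => f z + (-1) * g z).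
  exact/in_L2D/in_L2Z.
by apply/funext => z; rewrite mulN1r.
Qed.

Lemma Rintegral_sqrD (c : R) f g : in_L2 mu D f -> in_L2 mu D g ->
  \int[mu]_(z in D) ((f z + c * g z) ^+ 2) =
  \int[mu]_(z in D) (f z ^+ 2) + 2 * c * \int[mu]_(z in D) (f z * g z) +
  c ^+ 2 * \int[mu]_(z in D) (g z ^+ 2).
Proof.
move=> Lf Lg.
have If := in_L2_integrable_sqr Lf; have Ig := in_L2_integrable_sqr Lg.
have Ifg := in_L2_integrable_mul Lf Lg.
rewrite -!RintegralZl// -!RintegralD//.
- by apply: eq_Rintegral => z _; ring.
- exact/integrable_EFinD/integrable_EFinZ.
- exact: integrable_EFinZ.
- exact: integrable_EFinZ.
Qed.

(** The quadratic polynomial [t |-> \int (f + t * g)^2] is nonnegative; it is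
    evaluated at its minimum, or far out on the line if [g] has norm zero. *)
Lemma Rintegral_cauchy_schwarz f g : in_L2 mu D f -> in_L2 mu D g ->
  (\int[mu]_(z in D) (f z * g z)) ^+ 2 <=
  \int[mu]_(z in D) (f z ^+ 2) * \int[mu]_(z in D) (g z ^+ 2).
Proof.
move=> Lf Lg.
set a := \int[mu]_(z in D) (f z ^+ 2).
set b := \int[mu]_(z in D) (f z * g z).
set c := \int[mu]_(z in D) (g z ^+ 2).
have q t : 0 <= a + 2 * t * b + t ^+ 2 * c.
  by rewrite -Rintegral_sqrD//; apply: Rintegral_ge0 => z _; exact: sqr_ge0.
have c0 : 0 <= c by apply: Rintegral_ge0 => z _; exact: sqr_ge0.
have a0 : 0 <= a by apply: Rintegral_ge0 => z _; exact: sqr_ge0.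
have [c0'|cN0] := eqVneq c 0.
  have [->|bN0] := eqVneq b 0; first by rewrite expr0n/= mulr_ge0.
  (* at this value of [t] the affine polynomial [a + 2 * t * b] equals [-1] *)
  have := q (- (a + 1) / (2 * b)).
  rewrite c0' mulr0 addr0 (_ : 2 * _ * b = - (a + 1)); last by field.
  by rewrite opprD addrA subrr sub0r ler0N1.
have cp : 0 < c by rewrite lt_def cN0.
have := q (- b / c).
rewrite (_ : a + _ + _ = a - b ^+ 2 / c); last by field.
by rewrite subr_ge0 ler_pdivrMr.
Qed.

(** Strong convergence implies weak convergence; this is how an identity
    passes from smooth functions to Sobolev functions. *)
Lemma cvg_L2_Rintegral_mul g (f_ : nat -> X -> R) f :
  in_L2 mu D g -> (forall n, in_L2 mu D (f_ n)) -> in_L2 mu D f ->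
  cvg_L2 mu D f_ f ->
  \int[mu]_(z in D) (g z * f_ n z) @[n --> \oo] -->
    \int[mu]_(z in D) (g z * f z).
Proof.
move=> Lg Lf_ Lf fcvg.
pose G := \int[mu]_(z in D) (g z ^+ 2).
have G0 : 0 <= G by apply: Rintegral_ge0 => z _; exact: sqr_ge0.
have dc : \int[mu]_(z in D) ((f_ n z - f z) ^+ 2) @[n --> \oo] --> 0.
  exact: (fine_cvg fcvg).
apply/cvgrPdist_lt => e e0.
have e1 : 0 < e ^+ 2 / (G + 1) by rewrite divr_gt0// ?exprn_gt0//; lra.
move/cvgrPdist_lt : dc => /(_ _ e1); apply: filterS => n.
rewrite sub0r normrN ger0_norm; last first.
  by apply: Rintegral_ge0 => z _; exact: sqr_ge0.
rewrite ltr_pdivlMr; last by lra.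
move=> H; rewrite distrC.
rewrite -(@ltr_pXn2r _ 2)// ?nnegrE ?normr_ge0 ?(ltW e0)//.
rewrite real_normK ?num_real// -RintegralB//;
  [|exact: in_L2_integrable_mul..].
rewrite (_ : Rintegral _ _ _ = \int[mu]_(z in D) (g z * (f_ n z - f z))).
  apply: (le_lt_trans (Rintegral_cauchy_schwarz Lg (in_L2B (Lf_ n) Lf))).
  apply: le_lt_trans H.
  rewrite mulrC ler_wpM2l//; last by rewrite /G; lra.
  by apply: Rintegral_ge0 => z _; exact: sqr_ge0.
by apply: eq_Rintegral => z _; rewrite mulrBr.
Qed.

(** A small distance between [f] and [g] forces the mixed integral to be close
    to the energy of [g]: the second bound is the Cauchy-Schwarz inequality
    for [f - g] and [g]. *)
Lemma Rintegral_sqr_dist f g : in_L2 mu D f -> in_L2 mu D g ->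
  let a := \int[mu]_(z in D) (f z ^+ 2) in
  let b := \int[mu]_(z in D) (f z * g z) in
  let c := \int[mu]_(z in D) (g z ^+ 2) in
  0 <= a - 2 * b + c /\ (b - c) ^+ 2 <= (a - 2 * b + c) * c.
Proof.
move=> Lf Lg a b c.
have E : \int[mu]_(z in D) ((f z + (-1) * g z) ^+ 2) = a - 2 * b + c.
  by rewrite Rintegral_sqrD// -/a -/b -/c; ring.
split; first by rewrite -E; apply: Rintegral_ge0 => z _; exact: sqr_ge0.
have Lfg := in_L2D Lf (in_L2Z (-1) Lg).
have := Rintegral_cauchy_schwarz Lfg Lg.
rewrite E -/c; congr (_ ^+ 2 <= _).
rewrite -RintegralB//;
  [|exact: in_L2_integrable_mul|exact: in_L2_integrable_sqr].
by apply: eq_Rintegral => z _; ring.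
Qed.

Lemma cvg_L2_cst f : cvg_L2 mu D (fun=> f) f.
Proof.
rewrite /cvg_L2 (_ : (fun _ : nat => _) = cst 0%E); first exact: cvg_cst.
by apply/funext => n; rewrite integral0_eq// => z _; rewrite subrr expr0n.
Qed.

Lemma cvg_L2Z (c : R) (f_ : nat -> X -> R) f :
  (forall n, measurable_fun D (f_ n)) -> measurable_fun D f ->
  cvg_L2 mu D f_ f ->
  cvg_L2 mu D (fun n z => c * f_ n z) (fun z => c * f z).
Proof.
move=> mf_ mf cf; rewrite /cvg_L2.
have E n : (\int[mu]_(z in D) ((c * f_ n z - c * f z) ^+ 2)%:E =
   (c ^+ 2)%:E * \int[mu]_(z in D) ((f_ n z - f z) ^+ 2)%:E)%E.
  rewrite -ge0_integralZl//.
  - by apply: eq_integral => z _; rewrite -EFinM -mulrBr exprMn.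
  - by apply/measurable_EFinP; apply: measurable_funX; exact: measurable_funB.
  - by move=> z _; rewrite lee_fin sqr_ge0.
  - by rewrite lee_fin sqr_ge0.
under eq_fun do rewrite E.
rewrite (_ : 0%E = (c ^+ 2)%:E * 0)%E; last by rewrite mule0.
exact: cvgeZl.
Qed.

End SquareIntegrable.

Section Triangle.
Context {R : realType}.
Local Notation plane := (measurableTypeR R * measurableTypeR R)%type.
Local Notation leb := (@lebesgue_measure R).
Implicit Types (q l : R).

(** * Smooth and continuous functions on the triangle *)

Lemma smooth_differentiable (f : R * R -> R) z : smooth f -> differentiable f z.
Proof. by move=> sf; exact: (sf [::]). Qed.

Lemma smooth_continuous (f : R * R -> R) : smooth f -> continuous f.
Proof.
by move=> sf z; exact/differentiable_continuous/smooth_differentiable.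
Qed.

Lemma smooth_derive v (f : R * R -> R) : smooth f -> smooth ('D_v f).
Proof.
by move=> sf s z; have := sf (rcons s v) z; rewrite -cats1 foldr_cat.
Qed.

Lemma differentiable_fst (z : R * R) : differentiable (fst : R * R -> R) z.
Proof.
apply: (@linear_differentiable _ _ _ (fst : {linear (R^o * R^o)%type -> R^o})).
by move=> w; exact: cvg_fst.
Qed.

Lemma derive_fst (v z : R * R) : 'D_v (fst : R * R -> R) z = v.1.
Proof.
rewrite deriveE; last exact: differentiable_fst.
by rewrite (@diff_lin _ _ _ (fst : {linear (R^o * R^o)%type -> R^o}))// => w;
  exact: cvg_fst.
Qed.

(** Iterated derivatives of the abscissa are the abscissa or constants. *)
Lemma smooth_fst : smooth (fst : R * R -> R).
Proof.
move=> s z.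
have [->|[c ->]] : foldr (fun v (g : R * R -> R) => 'D_v g) fst s = fst \/
    exists c, foldr (fun v (g : R * R -> R) => 'D_v g) fst s = cst c.
- elim: s => [|v s [IH|[c IH]]]; [by left|right..].
  + by exists v.1; apply/funext => w; rewrite /= IH derive_fst.
  + by exists 0; apply/funext => w; rewrite /= IH derive_cst.
- exact: differentiable_fst.
- exact: differentiable_cst.
Qed.

Lemma test_function_eq0 (D : set (R * R)) (phi : R * R -> R) z :
  test_function D phi -> ~ D z -> phi z = 0.
Proof.
move=> [_ _ sub] Dz; apply/eqP/negPn/negP => pz; apply: Dz.
by apply: sub; apply: subset_closure.
Qed.

(** The plane has a countable base of open squares with rational centre and
    radius, and these belong to the product sigma-algebra. *)
Lemma open_measurable_plane (W : set (R * R)) : open W ->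
  measurable (W : set plane).
Proof.
move=> oW.
pose sq (t : rat * rat * rat) : set plane :=
  ball (ratr t.1.1 : R) (ratr t.2) `*` ball (ratr t.1.2 : R) (ratr t.2).
pose F t : set plane := if `[< sq t `<=` (W : set plane) >] then sq t else set0.
rewrite (_ : W = \bigcup_t F t).
  apply: countable_bigcupT_measurable => // t; rewrite /F.
  by case: ifP => // _; apply: measurableX; exact: measurable_ball.
apply/seteqP; split => [z Wz|z [t _]]; last first.
  by rewrite /F; case: ifPn => // /asboolP; apply.
have /nbhs_ballP[e /= e0 zW] : nbhs z W by exact: open_nbhs_nbhs.
have [r] := rat_in_itvoo (divr_gt0 e0 (ltr0Sn R 1)).
rewrite in_itv/= => /andP[r0 re].
have zr (x : R) : x - ratr r < x + ratr r by lra.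
have [a] := rat_in_itvoo (zr z.1); rewrite in_itv/= => /andP[a1 a2].
have [b] := rat_in_itvoo (zr z.2); rewrite in_itv/= => /andP[b1 b2].
exists (a, b, r) => //; rewrite /F asboolT.
  by split; rewrite /ball/= ltr_norml; lra.
move=> w [/= w1 w2]; apply: zW; move: w1 w2; rewrite /ball/= !ltr_norml.
move=> /andP[? ?] /andP[? ?].
split; rewrite /ball/= ltr_norml; lra.
Qed.

Lemma continuous_measurable_plane (f : R * R -> R) : continuous f ->
  measurable_fun (setT : set plane) (f : plane -> R).
Proof.
move=> /continuousP cf; apply: (measurability _ (RGenOpens.measurableE R)).
move=> _ [_ [a [b ->] <-]]; rewrite setTI; apply: open_measurable_plane.
exact/cf/interval_open.
Qed.

Lemma triangle_open q : open (triangle q).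
Proof.
rewrite (_ : triangle q = (fst @^-1` [set x : R | 0 < x] `&`
   fst @^-1` [set x : R | x < q]) `&` (snd @^-1` [set x : R | 0 < x] `&`
   (fun z : R * R => z.2 + z.1 / q) @^-1` [set x : R | x < 1])); last first.
  apply/seteqP; split => z; rewrite /triangle/=.
    by move=> [/andP[-> ->] /andP[-> ?]]; do ?split => //; lra.
  by move=> [[-> ->] [-> ?]]; do ?split => //=; lra.
have cf : continuous (fun z : R * R => z.1) by move=> z; exact: cvg_fst.
have cs : continuous (fun z : R * R => z.2) by move=> z; exact: cvg_snd.
apply: openI; apply: openI.
- by apply: open_comp => [z _|]; [exact: cf | exact: open_gt].
- by apply: open_comp => [z _|]; [exact: cf | exact: open_lt].
- by apply: open_comp => [z _|]; [exact: cs | exact: open_gt].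
- apply: open_comp => [z _|]; last exact: open_lt.
  by apply: cvgD; [exact: cs | apply: cvgMl; exact: cf].
Qed.

Lemma triangle_measurable q : measurable (triangle q : set plane).
Proof. by apply: open_measurable_plane; exact: triangle_open. Qed.

Lemma triangle_sub_rectangle q :
  triangle q `<=` (`[0, q] `*` `[0, 1] : set (R * R)).
Proof.
move=> z; rewrite /triangle/= !in_itv/= => -[/andP[z0 zq] /andP[z1 zz]].
have : 0 < z.1 / q by rewrite divr_gt0// (lt_trans z0).
by split; lra.
Qed.

Lemma leb2_triangle_lty q : (leb2 (triangle q : set plane) < +oo)%E.
Proof.
apply: (@le_lt_trans _ _ (leb2 (`[0%R, q] `*` `[0%R, 1%R] : set plane))).
  apply: le_measure; rewrite ?inE.
  - exact: triangle_measurable.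
  - exact: measurableX.
  - exact: triangle_sub_rectangle.
have -> : leb2 (`[0%R, q] `*` `[0%R, 1%R] : set plane) =
    (lebesgue_measure `[0%R, q] * lebesgue_measure `[0%R, 1%R])%E.
  exact: product_measure1E.
rewrite !lebesgue_measure_itv/=.
by do 2 case: ifP => _; rewrite ?mule0 ?mul0e// -?EFinD -?EFinM ltry.
Qed.

Lemma continuous_bounded_triangle q (f : R * R -> R) : continuous f ->
  exists M, forall z, triangle q z -> `|f z| <= M.
Proof.
move=> cf.
have cK : compact (f @` (`[0, q] `*` `[0, 1] : set (R * R))).
  apply: continuous_compact; first exact: continuous_subspaceT.
  by apply: compact_setX; exact: segment_compact.
have [M [Mr HM]] := compact_bounded cK.
exists (M + 1) => z qz; apply: (HM (M + 1)); first by rewrite ltrDl.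
by exists z => //; exact: triangle_sub_rectangle.
Qed.

Lemma continuous_integrable_triangle q (f : R * R -> R) : continuous f ->
  leb2.-integrable (triangle q) (EFin \o f).
Proof.
move=> cf; apply: measurable_bounded_integrable.
- exact: triangle_measurable.
- exact: leb2_triangle_lty.
- by apply: measurable_funTS; exact: continuous_measurable_plane.
- have [M HM] := continuous_bounded_triangle q cf.
  exists M; split; first exact: num_real.
  by move=> x Mx z /HM /le_trans; apply; exact: ltW.
Qed.

Lemma continuous_in_L2_triangle q (f : R * R -> R) : continuous f ->
  in_L2 leb2 (triangle q) f.
Proof.
move=> cf; apply: in_L2_integrable_sqrP.
  by apply: measurable_funTS; exact: continuous_measurable_plane.
apply: continuous_integrable_triangle => z.
apply: (@continuous_comp _ _ _ f (fun x : R => x ^+ 2)); first exact: cf.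
exact: exprn_continuous.
Qed.

Lemma in_L2_integrable_triangle q (f : R * R -> R) :
  in_L2 leb2 (triangle q) f ->
  leb2.-integrable (triangle q) (EFin \o f).
Proof.
move=> Lf.
have c1 : continuous (fun _ : R * R => 1 : R) by move=> z; exact: cvg_cst.
have := in_L2_integrable_mul (triangle_measurable q) Lf
  (continuous_in_L2_triangle q c1).
by under eq_fun do rewrite mulr1.
Qed.

Lemma continuous_in_L2_itv (f : R -> R) (a b : R) : continuous f ->
  in_L2 leb `]a, b[ f.
Proof.
move=> cf; apply: in_L2_integrable_sqrP => //.
  by apply: measurable_funTS; exact: continuous_measurable_fun.
have cfi : leb.-integrable `[a, b] (EFin \o (fun x => f x ^+ 2)).
  apply: continuous_compact_integrable; first exact: segment_compact.
  apply: continuous_subspaceT => x.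
  apply: (@continuous_comp _ _ _ f (fun x : R => x ^+ 2)); first exact: cf.
  exact: exprn_continuous.
by apply: integrableS cfi => //; exact: subset_itv_oo_cc.
Qed.

(** * Integration over the triangle by slices *)

Lemma is_derive_slice_x (f : R * R -> R) (x y : R) : differentiable f (x, y) ->
  is_derive x 1 (fun t => f (t, y)) ('D_(e_x R) f (x, y)).
Proof.
move=> df.
have H : (fun h : R =>
      h^-1 *: (((fun t => f (t, y)) \o shift x) (h *: 1) - f (x, y)))
  = (fun h : R => h^-1 *: ((f \o shift (x, y)) (h *: (e_x R)) - f (x, y))).
  apply/funext => h /=; congr (_ *: (f _ - _)).
  by congr pair; rewrite /= ?scaler0 ?add0r.
apply: DeriveDef; first by rewrite /derivable H; exact: diff_derivable.
by rewrite /derive H.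
Qed.

Lemma is_derive_slice_y (f : R * R -> R) (x y : R) : differentiable f (x, y) ->
  is_derive y 1 (fun t => f (x, t)) ('D_(e_y R) f (x, y)).
Proof.
move=> df.
have H : (fun h : R =>
      h^-1 *: (((fun t => f (x, t)) \o shift y) (h *: 1) - f (x, y)))
  = (fun h : R => h^-1 *: ((f \o shift (x, y)) (h *: (e_y R)) - f (x, y))).
  apply/funext => h /=; congr (_ *: (f _ - _)).
  by congr pair; rewrite /= ?scaler0 ?add0r.
apply: DeriveDef; first by rewrite /derivable H; exact: diff_derivable.
by rewrite /derive H.
Qed.

Lemma is_derive_scaleX (c : R) (f : R -> R) n (x df : R) : is_derive x 1 f df ->
  is_derive x 1 (fun t => c * f t ^+ n) (c * (n%:R * f x ^+ n.-1 * df)).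
Proof.
move=> dfx.
have dfX := is_deriveX n dfx.
have -> : (fun t => c * f t ^+ n) = (c \*: (f ^+ n : R -> R^o)).
  by apply/funext => t; rewrite exprfctE.
exact: is_deriveZ.
Qed.

Lemma FTC2_oo (G g : R -> R) (a b : R) : a < b -> continuous g ->
    (forall x : R, is_derive x 1 G (g x)) ->
  (\int[leb]_(x in `]a, b[) (g x)%:E = (G b - G a)%:E)%E.
Proof.
move=> ab cg dG.
have dG1 (x : R) : derivable G x 1 by case: (dG x).
have cG : continuous G.
  by move=> x; apply: differentiable_continuous; exact/derivable1_diffP.
rewrite -(integral_itv_bndoo true false).
  rewrite (@continuous_FTC2 _ g G)//.
  - exact: continuous_subspaceT.
  - split.
    + by [].
    + by apply: cvg_at_right_filter; exact: cG.
    + by apply: cvg_at_left_filter; exact: cG.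
  - by move=> x _; rewrite derive1E; case: (dG x).
apply/measurable_EFinP/measurable_funTS.
exact: continuous_measurable_fun.
Qed.

Lemma continuous_slice_x (g : R * R -> R) (y : R) : continuous g ->
  continuous (fun t : R => g (t, y)).
Proof.
move=> cg t.
apply: (@cvg_comp _ _ _ (fun t : R => (t, y)) g _ (nbhs (t, y)));
  last exact: cg.
have ct : (fun s : R => s) s @[s --> t] --> t by [].
have cy : (fun _ : R => y) s @[s --> t] --> y by exact: cvg_cst.
exact: (cvg_pair ct cy).
Qed.

Lemma continuous_slice_y (g : R * R -> R) (x : R) : continuous g ->
  continuous (fun t : R => g (x, t)).
Proof.
move=> cg t.
apply: (@cvg_comp _ _ _ (fun t : R => (x, t)) g _ (nbhs (x, t)));
  last exact: cg.
have ct : (fun s : R => s) s @[s --> t] --> t by [].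
have cx : (fun _ : R => x) s @[s --> t] --> x by exact: cvg_cst.
exact: (cvg_pair cx ct).
Qed.

Lemma integrable_patch_triangle q (g : R * R -> R) : continuous g ->
  leb2.-integrable setT (((EFin \o g) : plane -> \bar R) \_ (triangle q)).
Proof.
move=> cg; apply/(integrable_mkcond _ (triangle_measurable q)).
exact: continuous_integrable_triangle.
Qed.

(** Fubini's theorem with the abscissa as inner variable, then the fundamental
    theorem of calculus on each horizontal slice. *)
Lemma triangle_FTC_x q (G g : R * R -> R) : 0 < q -> continuous g ->
    (forall x y : R, is_derive x 1 (fun t => G (t, y)) (g (x, y))) ->
  \int[leb2]_(z in triangle q) g z =
  \int[leb]_(y in `]0, 1[) (G (q * (1 - y), y) - G (0, y)).
Proof.
move=> q0 cg dG; congr fine.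
rewrite integral_mkcond -integral21_prod_meas1; last first.
  exact: integrable_patch_triangle.
rewrite [RHS]integral_mkcond; apply: eq_integral => y _.
rewrite /fubini_G [in RHS]patchE; case: ifPn => [|].
  rewrite inE/= in_itv/= => /andP[y0 y1].
  have b0 : 0 < q * (1 - y) by rewrite mulr_gt0// subr_gt0.
  rewrite -(@FTC2_oo (fun t => G (t, y)) (fun t => g (t, y)))//; last first.
    move=> x; exact: continuous_slice_x.
  rewrite [RHS]integral_mkcond; apply: eq_integral => x _.
  rewrite !patchE/=; congr (if _ then _ else _).
  apply/idP/idP; rewrite !inE /triangle/= in_itv/=.
    move=> [/andP[-> xq] /andP[_ yx]] /=.
    by rewrite mulrC -ltr_pdivrMr//; lra.
  move=> /andP[x0 xb]; rewrite x0 y0/=.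
  move: (xb); rewrite mulrC -ltr_pdivrMr// => xq.
  split; last lra.
  by apply: (lt_trans xb); rewrite gtr_pMr//; lra.
rewrite notin_setE/= in_itv/= => y01.
rewrite integral0_eq// => x _; rewrite patchE; case: ifPn => //.
rewrite inE /triangle/= => -[/andP[x0 xq] /andP[y0 yx]]; exfalso; apply: y01.
have : 0 < x / q by rewrite divr_gt0.
by rewrite y0/=; lra.
Qed.

(** The same on vertical slices. *)
Lemma triangle_FTC_y q (G g : R * R -> R) : 0 < q -> continuous g ->
    (forall x y : R, is_derive y 1 (fun t => G (x, t)) (g (x, y))) ->
  \int[leb2]_(z in triangle q) g z =
  \int[leb]_(x in `]0, q[) (G (x, 1 - x / q) - G (x, 0)).
Proof.
move=> q0 cg dG; congr fine.
rewrite integral_mkcond -integral12_prod_meas1; last first.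
  exact: integrable_patch_triangle.
rewrite [RHS]integral_mkcond; apply: eq_integral => x _.
rewrite /fubini_F [in RHS]patchE; case: ifPn => [|].
  rewrite inE/= in_itv/= => /andP[x0 xq].
  have b0 : 0 < 1 - x / q by rewrite subr_gt0 ltr_pdivrMr// mul1r.
  rewrite -(@FTC2_oo (fun t => G (x, t)) (fun t => g (x, t)))//; last first.
    move=> y; exact: continuous_slice_y.
  rewrite [RHS]integral_mkcond; apply: eq_integral => y _.
  rewrite !patchE/=; congr (if _ then _ else _).
  apply/idP/idP; rewrite !inE /triangle/= in_itv/= x0 xq/=.
    by case.
  by move=> ->.
rewrite notin_setE/= in_itv/= => y01.
rewrite integral0_eq// => y _; rewrite patchE; case: ifPn => //.
by rewrite inE /triangle/= => -[].
Qed.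

(** * Two test fields *)

(** The two weak derivatives are computed on slices: a primitive of the
    integrand is the product of the abscissa with the test function, which
    vanishes at both ends of every slice because its support lies in the open
    triangle. *)
Lemma H1_AC_fst q : 0 < q -> H1_AC q fst (cst 1) (cst 0).
Proof.
move=> q0.
have cfst : continuous (fst : R * R -> R) by move=> z; exact: cvg_fst.
have Dx : 'D_(e_x R) fst = cst 1 by apply/funext => z; rewrite derive_fst.
have Dy : 'D_(e_y R) fst = cst 0 by apply/funext => z; rewrite derive_fst.
split; last first.
  exists (fun=> fst); split.
  - by move=> _; exact: smooth_fst.
  - exact: cvg_L2_cst.
  - by rewrite Dx; exact: cvg_L2_cst.
  - by rewrite Dy; exact: cvg_L2_cst.
  - exact: cvg_L2_cst.
split.
- exact: continuous_in_L2_triangle.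
- by apply: continuous_in_L2_triangle => z; exact: cvg_cst.
- by apply: continuous_in_L2_triangle => z; exact: cvg_cst.
- move=> phi tphi; have [sphi _ _] := tphi.
  have cphi := smooth_continuous sphi.
  have cDphi := smooth_continuous (smooth_derive (e_x R) sphi).
  under [in RHS]eq_Rintegral do rewrite mul1r.
  have c1 : continuous (fun z : R * R => z.1 * 'D_(e_x R) phi z).
    by move=> z; apply: cvgM; [exact: cfst|exact: cDphi].
  apply/eqP; rewrite -addr_eq0 -RintegralD; last 3 first.
  - exact: triangle_measurable.
  - exact: continuous_integrable_triangle.
  - exact: continuous_integrable_triangle.
  have cg : continuous (fun z : R * R => z.1 * 'D_(e_x R) phi z + phi z).
    by move=> z; apply: cvgD; [exact: c1|exact: cphi].
  have dG (x y : R) : is_derive x 1 (fun t => t * phi (t, y))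
      (x * 'D_(e_x R) phi (x, y) + phi (x, y)).
    have ? := is_derive_slice_x (smooth_differentiable (x, y) sphi).
    by apply: is_derive_eq; rewrite /= /GRing.scale/= mulr1.
  rewrite (triangle_FTC_x (G := fun z => z.1 * phi z) q0 cg dG).
  rewrite (_ : Rintegral _ _ _ = \int[leb]_(y in `]0, 1[) 0).
    by rewrite Rintegral_cst// mul0r.
  apply: eq_Rintegral => y _; rewrite mul0r subr0.
  rewrite (test_function_eq0 (z := (q * (1 - y), y)) tphi) ?mulr0//.
  rewrite /triangle/= => -[_ /andP[_]].
  by rewrite mulrAC mulfV ?gt_eqF// mul1r; lra.
- move=> phi tphi; have [sphi _ _] := tphi.
  have cphi := smooth_continuous sphi.
  have cDphi := smooth_continuous (smooth_derive (e_y R) sphi).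
  under [in RHS]eq_Rintegral do rewrite mul0r.
  rewrite Rintegral_cst ?mul0r ?oppr0; last exact: triangle_measurable.
  have cg : continuous (fun z : R * R => z.1 * 'D_(e_y R) phi z).
    by move=> z; apply: cvgM; [exact: cfst|exact: cDphi].
  have dG (x y : R) : is_derive y 1 (fun t => x * phi (x, t))
      (x * 'D_(e_y R) phi (x, y)).
    have ? := is_derive_slice_y (smooth_differentiable (x, y) sphi).
    exact: is_derive_eq.
  rewrite (triangle_FTC_y (G := fun z => z.1 * phi z) q0 cg dG).
  rewrite (_ : Rintegral _ _ _ = \int[leb]_(y in `]0, q[) 0).
    by rewrite Rintegral_cst// mul0r.
  apply: eq_Rintegral => x _.
  rewrite !(test_function_eq0 tphi) ?mulr0 ?subrr// /triangle/= => -[_ /andP[]].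
    by rewrite ltxx.
  by rewrite ltxx.
Qed.

(** Horizontal distance to the hypotenuse; the field [(sigma, 0)] has
    divergence [-1] and no flux through the base and the hypotenuse. *)
Definition sigma q (z : R * R) : R := q * (1 - z.2) - z.1.

Lemma sigma_continuous q : continuous (sigma q).
Proof.
move=> z; apply: cvgB; last exact: cvg_fst.
apply: cvgMr; apply: cvgB; [exact: cvg_cst|exact: cvg_snd].
Qed.

Lemma derive_sigma q (x y : R) :
  is_derive x 1 (fun t => sigma q (t, y)) (-1).
Proof.
have -> : (fun t => sigma q (t, y)) = cst (q * (1 - y)) - id by [].
by apply: is_derive_eq; rewrite sub0r.
Qed.

Lemma Rintegral_onemX (c : R) n :
  \int[leb]_(y in `]0, 1[) (c * (1 - y) ^+ n) = c / n.+1%:R.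
Proof.
have cg : continuous (fun y : R => c * (1 - y) ^+ n).
  move=> y; apply: cvgM; first exact: cvg_cst.
  apply: (@continuous_comp _ _ _ (fun y : R => 1 - y) (fun y : R => y ^+ n)).
    by apply: cvgB => //; exact: cvg_cst.
  exact: exprn_continuous.
have dG (y : R) : is_derive y 1 (fun y => - c / n.+1%:R * (1 - y) ^+ n.+1)
    (c * (1 - y) ^+ n).
  have d1 : is_derive y 1 (fun y : R => 1 - y) (-1).
    have -> : (fun t : R => 1 - t) = cst 1 - id by [].
    by apply: is_derive_eq; rewrite sub0r.
  apply: (is_derive_eq (is_derive_scaleX (- c / n.+1%:R) n.+1 d1)) => /=.
  by field; rewrite nat1r pnatr_eq0.
rewrite /Rintegral (FTC2_oo ltr01 cg dG)/=.
by rewrite subrr subr0 expr0n/= expr1n mulr0 mulr1 sub0r mulNr opprK.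
Qed.

Lemma triangle_area q : 0 < q -> \int[leb2]_(z in triangle q) 1 = q / 2.
Proof.
move=> q0.
have cg : continuous (fun _ : R * R => 1 : R) by move=> z; exact: cvg_cst.
have dG (x y : R) : is_derive x 1 (fun t : R => t) 1 by exact: is_derive_id.
rewrite (triangle_FTC_x (G := fst) q0 cg dG).
under eq_Rintegral => y _ do rewrite /= subr0 -[1 - y]expr1.
exact: Rintegral_onemX.
Qed.

Lemma Rintegral_fst_triangle q : 0 < q ->
  \int[leb2]_(z in triangle q) z.1 = q ^+ 2 / 6.
Proof.
move=> q0.
have cg : continuous (fun z : R * R => z.1) by move=> z; exact: cvg_fst.
have dG (x y : R) : is_derive x 1 (fun t : R => 2^-1 * t ^+ 2) x.
  apply: (is_derive_eq (is_derive_scaleX 2^-1 2 (is_derive_id x (1 : R)))).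
  by field.
rewrite (triangle_FTC_x (G := fun z => 2^-1 * z.1 ^+ 2) q0 cg dG).
under eq_Rintegral => y _.
  rewrite (_ : _ - _ = q ^+ 2 / 2 * (1 - y) ^+ 2); last by rewrite /=; ring.
  over.
by rewrite Rintegral_onemX; field.
Qed.

Lemma Rintegral_sigma_sqr q : 0 < q ->
  \int[leb2]_(z in triangle q) (sigma q z ^+ 2) = q ^+ 3 / 12.
Proof.
move=> q0.
have cg : continuous (fun z => sigma q z ^+ 2).
  move=> z; apply: (@continuous_comp _ _ _ (sigma q) (fun x : R => x ^+ 2)).
    exact: sigma_continuous.
  exact: exprn_continuous.
have dG (x y : R) : is_derive x 1 (fun t : R => - 3^-1 * sigma q (t, y) ^+ 3)
    (sigma q (x, y) ^+ 2).
  apply: (is_derive_eq (is_derive_scaleX (- 3^-1) 3 (derive_sigma q x y))).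
  by field.
rewrite (triangle_FTC_x (G := fun z => - 3^-1 * sigma q z ^+ 3) q0 cg dG).
under eq_Rintegral => y _.
  rewrite (_ : _ - _ = q ^+ 3 / 3 * (1 - y) ^+ 3); last first.
    by rewrite /sigma /=; field.
  over.
by rewrite Rintegral_onemX; field.
Qed.

(** Green's formula for the field [(sigma, 0)]: the only boundary term comes
    from the vertical side. *)
Lemma Rintegral_sigma_derive_x q (phi : R * R -> R) : 0 < q -> smooth phi ->
  \int[leb2]_(z in triangle q) (sigma q z * 'D_(e_x R) phi z) =
  \int[leb2]_(z in triangle q) (1 * phi z) -
  \int[leb]_(y in `]0, 1[) (q * (1 - y) * phi (0, y)).
Proof.
move=> q0 sphi.
have cphi := smooth_continuous sphi.
have cDphi := smooth_continuous (smooth_derive (e_x R) sphi).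
under [in RHS]eq_Rintegral do rewrite mul1r.
have c1 : continuous (fun z : R * R => sigma q z * 'D_(e_x R) phi z).
  by move=> z; apply: cvgM; [exact: sigma_continuous|exact: cDphi].
have cg : continuous (fun z => phi z - sigma q z * 'D_(e_x R) phi z).
  by move=> z; apply: cvgB; [exact: cphi|exact: c1].
have dG (x y : R) : is_derive x 1 (fun t : R => - (sigma q (t, y) * phi (t, y)))
    (phi (x, y) - sigma q (x, y) * 'D_(e_x R) phi (x, y)).
  have ? := is_derive_slice_x (smooth_differentiable (x, y) sphi).
  have ? := derive_sigma q x y.
  by apply: is_derive_eq; rewrite /= /GRing.scale/=; ring.
have := triangle_FTC_x (G := fun z => - (sigma q z * phi z)) q0 cg dG.
rewrite RintegralB; last 3 first.
- exact: triangle_measurable.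
- exact: continuous_integrable_triangle.
- exact: continuous_integrable_triangle.
rewrite (_ : Rintegral leb _ _ =
    \int[leb]_(y in `]0, 1[) (q * (1 - y) * phi (0, y))); last first.
  by apply: eq_Rintegral => y _; rewrite /sigma/=; ring.
by move=> <-; rewrite subKr.
Qed.

(** Green's formula for smooth approximations of [u]; the boundary term
    disappears in the limit because the trace of [u] is zero. *)
Lemma Rintegral_H1_AC_sigma q u ux uy : 0 < q -> H1_AC q u ux uy ->
  \int[leb2]_(z in triangle q) u z =
  \int[leb2]_(z in triangle q) (sigma q z * ux z).
Proof.
move=> q0 [[Lu Lux _ _ _] [phi [sphi cu cux _ cw]]].
have mt := triangle_measurable q.
have cst1 : continuous (fun _ : R * R => 1 : R) by move=> z; exact: cvg_cst.
have cphi n := smooth_continuous (sphi n).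
have cDphi n := smooth_continuous (smooth_derive (e_x R) (sphi n)).
have L1 := cvg_L2_Rintegral_mul mt
  (continuous_in_L2_triangle q cst1)
  (fun n => continuous_in_L2_triangle q (cphi n)) Lu cu.
have L2 := cvg_L2_Rintegral_mul mt
  (continuous_in_L2_triangle q (@sigma_continuous q))
  (fun n => continuous_in_L2_triangle q (cDphi n)) Lux cux.
have cy : continuous (fun y : R => q * (1 - y)).
  by move=> y; apply: cvgMr; apply: cvgB => //; exact: cvg_cst.
have c0 : continuous (cst 0 : R -> R) by move=> y; exact: cvg_cst.
have m01 : measurable (`]0, 1[ : set (measurableTypeR R)).
  exact: measurable_itv.
have L3 := cvg_L2_Rintegral_mul m01
  (continuous_in_L2_itv 0 1 cy)
  (fun n => continuous_in_L2_itv 0 1 (continuous_slice_y (x := 0) (cphi n)))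
  (continuous_in_L2_itv 0 1 c0) cw.
have {L3 L1}L := cvgB L1 L3.
under [in LHS]eq_Rintegral => z _ do rewrite -[u z]mul1r.
have w0 : \int[leb]_(y in `]0, 1[) (q * (1 - y) * cst 0 y) = 0.
  by under eq_Rintegral do rewrite mulr0; rewrite Rintegral_cst// mul0r.
rewrite -(cvg_lim (@Rhausdorff R) L2); apply/esym/cvg_lim => //.
under eq_fun => n do rewrite (Rintegral_sigma_derive_x q0 (sphi n)).
by rewrite w0 subr0 in L; exact: L.
Qed.

(** * The horizontal energy exceeds the vertical one *)

Section WeakSolutionBounds.
Variables (q : R) (u ux uy : R * R -> R).
Hypotheses (q0 : 0 < q) (wu : weak_solution q u ux uy).
Let T := \int[leb2]_(z in triangle q) u z.
Let A := \int[leb2]_(z in triangle q) (ux z ^+ 2).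
Let B := \int[leb2]_(z in triangle q) (uy z ^+ 2).

(** The solution is tested against itself. *)
Lemma energy_identity : A + B = T.
Proof.
case: wu => Hu /(_ _ _ _ Hu); rewrite -/T => <-.
case: Hu => -[_ Lux Luy _ _] _.
have mt := triangle_measurable q.
by rewrite /A /B -RintegralD//; exact: in_L2_integrable_sqr.
Qed.

(** Expand the nonnegative integral of [(sigma - ux)^2]. *)
Lemma torsion_le_x_energy : T <= q ^+ 3 / 24 + A / 2.
Proof.
have Hu : H1_AC q u ux uy by case: wu.
have Lux : in_L2 leb2 (triangle q) ux by case: Hu => -[].
have Ls := continuous_in_L2_triangle q (@sigma_continuous q).
have mt := triangle_measurable q.
have : 0 <= \int[leb2]_(z in triangle q) ((sigma q z + (-1) * ux z) ^+ 2).
  by apply: Rintegral_ge0 => z _; exact: sqr_ge0.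
rewrite Rintegral_sqrD// -(Rintegral_H1_AC_sigma q0 Hu) Rintegral_sigma_sqr//.
by rewrite -/A -/T; lra.
Qed.

(** Expand the nonnegative integral of [(ux - q / 3)^2], the integral of [ux]
    being known from the test function [x]. The constant [q / 3] is the mean
    value of [ux], hence the optimal one. *)
Lemma x_energy_ge : q ^+ 3 / 18 <= A.
Proof.
have Hu : H1_AC q u ux uy by case: wu.
have Lux : in_L2 leb2 (triangle q) ux by case: Hu => -[].
have mt := triangle_measurable q.
have L1 : in_L2 leb2 (triangle q) (cst 1 : R * R -> R).
  by apply: continuous_in_L2_triangle => z; exact: cvg_cst.
have Iu : \int[leb2]_(z in triangle q) (ux z * 1) = q ^+ 2 / 6.
  rewrite -Rintegral_fst_triangle//.
  case: wu => _ /(_ _ _ _ (H1_AC_fst q0)) <-.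
  by apply: eq_Rintegral => z _; rewrite mulr0 addr0.
have : 0 <= \int[leb2]_(z in triangle q) ((ux z + (- (q / 3)) * 1) ^+ 2).
  by apply: Rintegral_ge0 => z _; exact: sqr_ge0.
rewrite (Rintegral_sqrD mt _ Lux L1) Iu -/A.
under [X in _ + _ * X]eq_Rintegral do rewrite expr1n.
rewrite triangle_area//.
lra.
Qed.

(** Since [B = T - A], the claim is [T < 2 * A]; the two bounds give
    [T <= 3 / 4 * A + A / 2]. *)
Lemma y_energy_lt_x_energy : B < A.
Proof.
have := energy_identity; have := torsion_le_x_energy; have := x_energy_ge.
have : 0 < q ^+ 3 by rewrite exprn_gt0.
lra.
Qed.

Lemma torsion_le_cube : T <= q ^+ 3 / 12.
Proof.
have := energy_identity; have := torsion_le_x_energy.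
have : 0 <= B by apply: Rintegral_ge0 => z _; exact: sqr_ge0.
lra.
Qed.

End WeakSolutionBounds.

(** * Horizontal stretching *)

Definition stretch l (z : R * R) : R * R := (l * z.1, z.2).

Lemma stretch_continuous l : continuous (stretch l).
Proof.
move=> z.
have c1 : (fun w : R * R => l * w.1) w @[w --> z] --> l * z.1.
  by apply: cvgMr; exact: cvg_fst.
have c2 : (fun w : R * R => w.2) w @[w --> z] --> z.2 by exact: cvg_snd.
exact: (cvg_pair c1 c2).
Qed.

Lemma measurable_stretch l :
  measurable_fun (setT : set plane) (stretch l : plane -> plane).
Proof.
apply/measurable_fun_pairP; split => /=.
  exact: (@measurable_funM _ plane R setT (cst l) fst
    (measurable_cst _) measurable_fst).
exact: measurable_snd.
Qed.

(** Both sides define measures that agree on half-open intervals. *)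
Lemma lebesgue_measure_dilate l (A : set (measurableTypeR R)) :
  0 < l -> measurable A ->
  leb A = (l%:E * leb ((fun x => l * x)%R @^-1` A))%E.
Proof.
move=> l0 mA.
have mf : measurable_fun setT
    ((fun x => l * x) : measurableTypeR R -> measurableTypeR R).
  exact: measurable_funM.
(* [nu] takes the measurability proof [mf] as an argument *)
pose nu := mscale (NngNum (ltW l0))
  (pushforward leb ((fun x => l * x) : measurableTypeR R -> measurableTypeR R)).
apply: (@lebesgue_measure_unique R (nu mf)) => //.
move=> _ [[a b]] _ <-.
rewrite -[RHS]/(l%:E * leb ((fun x => l * x)%R @^-1` `]a, b]))%E.
rewrite (_ : _ @^-1` _ = `]a / l, b / l]%classic); last first.
  apply/seteqP; split => x /=; rewrite !in_itv/=.
    by move=> /andP[? ?]; rewrite ltr_pdivrMr// ler_pdivlMr// mulrC; apply/andP.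
  by rewrite ltr_pdivrMr// ler_pdivlMr// mulrC.
rewrite !lebesgue_measure_itv/= !lte_fin ltr_pM2r ?invr_gt0//.
case: ifPn => ab; last by rewrite mule0.
by rewrite -!EFinB -EFinM -mulrBl mulrC divfK// gt_eqF.
Qed.

(** Both sides define measures that agree on rectangles. *)
Lemma leb2_stretch l (A : set plane) : 0 < l -> measurable A ->
  leb2 A = (l%:E * leb2 (stretch l @^-1` A))%E.
Proof.
move=> l0 mA.
have mf := measurable_stretch l.
pose nu := mscale (NngNum (ltW l0))
  (pushforward (leb2 : set plane -> \bar R) (stretch l : plane -> plane)).
apply: (@product_measure_unique _ _ _ _ _ leb leb (nu mf)) => //.
move=> X Y mX mY.
rewrite -[LHS]/(l%:E * leb2 (stretch l @^-1` (X `*` Y)))%E.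
rewrite (_ : _ @^-1` _ = ((fun x => l * x) @^-1` X) `*` Y)//.
rewrite [X in (_ * X)%E](product_measure1E leb leb _ mY); last first.
  rewrite -[X in measurable X]setTI.
  exact: (@measurable_funM _ _ R setT (cst l) id).
by rewrite muleA -(lebesgue_measure_dilate l0).
Qed.

Lemma ge0_integral_stretch l (D : set plane) (f : plane -> \bar R) : 0 < l ->
  measurable D -> measurable_fun D f -> (forall z, D z -> (0 <= f z)%E) ->
  (\int[leb2]_(z in D) f z =
   l%:E * \int[leb2]_(z in stretch l @^-1` D) f (stretch l z))%E.
Proof.
move=> l0 mD mf f0.
have ms := measurable_stretch l.
pose mu' : {measure set plane -> \bar R} :=
  pushforward (leb2 : set plane -> \bar R) (stretch l : plane -> plane).
pose mu := mu' ms.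
transitivity (\int[mscale (NngNum (ltW l0)) mu]_(z in D) f z)%E.
  by apply: eq_measure_integral => A mA _; exact: leb2_stretch.
transitivity (l%:E * \int[mu]_(z in D) f z)%E.
  exact: (@ge0_integral_mscale _ _ _ mu D mD (NngNum (ltW l0)) f mf f0).
have f0' : {in D, forall z, (0 <= f z)%E} by move=> z; rewrite inE; exact: f0.
exact: (f_equal (fun x => l%:E * x)%E
  (ge0_integral_pushforward ms leb2 mD mf f0')).
Qed.

Lemma measurable_preimage_stretch l (D : set plane) : measurable D ->
  measurable (stretch l @^-1` D : set plane).
Proof.
by move=> mD; rewrite -[X in measurable X]setTI; exact: measurable_stretch.
Qed.

Lemma measurable_fun_stretch l (D : set plane) (f : plane -> R) :
  measurable D -> measurable_fun D f ->
  measurable_fun (stretch l @^-1` D) (fun z => f (stretch l z)).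
Proof.
move=> mD mf; apply: (measurable_comp mD _ mf).
  by move=> _ [z Dz <-].
by apply: measurable_funTS; exact: measurable_stretch.
Qed.

Lemma lte_pmul_pinfty l (x : \bar R) : 0 < l -> (0 <= x)%E ->
  (l%:E * x < +oo)%E -> (x < +oo)%E.
Proof.
move=> l0; case: x => [r _ _|_|//]; first exact: ltry.
by rewrite gt0_muley ?lte_fin// ltxx.
Qed.

Lemma integrable_stretch l (D : set plane) (f : plane -> R) : 0 < l ->
  measurable D -> leb2.-integrable D (EFin \o f) ->
  leb2.-integrable (stretch l @^-1` D) (EFin \o (fun z => f (stretch l z))).
Proof.
move=> l0 mD /integrableP[/measurable_EFinP mf fi]; apply/integrableP; split.
  by apply/measurable_EFinP; exact: measurable_fun_stretch.
apply: (lte_pmul_pinfty l0); first exact: integral_ge0.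
have mabs : measurable_fun D (fun z => `|(f z)%:E|%E).
  by apply: measurableT_comp => //; exact/measurable_EFinP.
by rewrite -(ge0_integral_stretch l0 mD mabs).
Qed.

Lemma Rintegral_stretch l (D : set plane) (f : plane -> R) : 0 < l ->
  measurable D -> leb2.-integrable D (EFin \o f) ->
  \int[leb2]_(z in D) f z =
  l * \int[leb2]_(z in stretch l @^-1` D) f (stretch l z).
Proof.
move=> l0 mD fi.
have mf : measurable_fun D (EFin \o f) by case/integrableP : fi.
have si := integrable_stretch l0 mD fi.
have mS := measurable_preimage_stretch l mD.
pose g := (EFin \o f) \o stretch l.
have Ep : (\int[leb2]_(z in D) (EFin \o f)^\+ z =
    l%:E * \int[leb2]_(z in stretch l @^-1` D) g^\+ z)%E.
  rewrite [in RHS]funepos_comp.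
  exact (ge0_integral_stretch l0 mD (measurable_funepos mf)
    (fun z _ => funepos_ge0 _ z)).
have En : (\int[leb2]_(z in D) (EFin \o f)^\- z =
    l%:E * \int[leb2]_(z in stretch l @^-1` D) g^\- z)%E.
  rewrite [in RHS]funeneg_comp.
  exact (ge0_integral_stretch l0 mD (measurable_funeneg mf)
    (fun z _ => funeneg_ge0 _ z)).
have gp := integrable_fin_num mS (integrable_funepos mS si).
have gi := integrable_fin_num mS si.
have E : (\int[leb2]_(z in D) (f z)%:E =
    l%:E * \int[leb2]_(z in stretch l @^-1` D) g z)%E.
  rewrite integralE Ep En -muleBr; [by rewrite -integralE|by []|].
  exact: fin_num_adde_defr gp.
by rewrite /Rintegral E fineM.
Qed.

Lemma in_L2_stretch l (D : set plane) (f : plane -> R) :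
  0 < l -> measurable D ->
  in_L2 leb2 D f ->
  in_L2 leb2 (stretch l @^-1` D) (fun z => f (stretch l z)).
Proof.
move=> l0 mD [mf fi]; split; first exact: measurable_fun_stretch.
move: fi; rewrite (@ge0_integral_stretch l)//; last 2 first.
- by apply/measurable_EFinP; exact: measurable_funX.
- by move=> z _; rewrite lee_fin sqr_ge0.
have : (0 <= \int[leb2]_(z in stretch l @^-1` D) (f (stretch l z) ^+ 2)%:E)%E.
  by apply: integral_ge0 => z _; rewrite lee_fin sqr_ge0.
exact: lte_pmul_pinfty.
Qed.

Lemma cvg_L2_stretch l (D : set plane) (f_ : nat -> plane -> R) f : 0 < l ->
  measurable D -> (forall n, measurable_fun D (f_ n)) -> measurable_fun D f ->
  cvg_L2 leb2 D f_ f ->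
  cvg_L2 leb2 (stretch l @^-1` D) (fun n z => f_ n (stretch l z))
    (fun z => f (stretch l z)).
Proof.
move=> l0 mD mf_ mf; rewrite /cvg_L2.
have E n : (\int[leb2]_(z in D) ((f_ n z - f z) ^+ 2)%:E =
   l%:E * \int[leb2]_(z in stretch l @^-1` D)
      ((f_ n (stretch l z) - f (stretch l z)) ^+ 2)%:E)%E.
  rewrite (@ge0_integral_stretch l)//.
  - by apply/measurable_EFinP; apply: measurable_funX; exact: measurable_funB.
  - by move=> z _; rewrite lee_fin sqr_ge0.
under eq_fun do rewrite E.
move=> cE; have : (l^-1%:E * (l%:E * \int[leb2]_(z in stretch l @^-1` D)
      ((f_ n (stretch l z) - f (stretch l z)) ^+ 2)%:E))%E @[n --> \oo] -->
      (l^-1%:E * 0)%E.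
  exact: cvgeZl.
rewrite mule0; under eq_fun do rewrite muleA -EFinM mulVf ?gt_eqF// mul1e.
exact.
Qed.

(** The stretch being linear, both sides are limits of the same difference
    quotients. *)
Lemma derive_stretch l (f : R * R -> R) (v z : R * R) :
  'D_v (fun w => f (stretch l w)) z = 'D_(stretch l v) f (stretch l z).
Proof.
have E : (fun h : R => h^-1 *: (((fun w => f (stretch l w)) \o shift z) (h *: v)
      - f (stretch l z))) =
    (fun h : R => h^-1 *: ((f \o shift (stretch l z)) (h *: stretch l v)
      - f (stretch l z))).
  apply/funext => h /=; congr (_ *: (f _ - _)); rewrite /stretch/=.
  by congr pair; rewrite mulrDr mulrCA.
by rewrite /derive E.
Qed.

Lemma differentiable_stretch l z : differentiable (stretch l) z.
Proof.
apply: differentiable_pair; last first.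
  apply: (@linear_differentiable _ _ _
    (snd : {linear (R^o * R^o)%type -> R^o})).
  by move=> w; exact: cvg_snd.
apply: differentiableM; first exact: differentiable_cst.
exact: differentiable_fst.
Qed.

Lemma smooth_stretch l (f : R * R -> R) : smooth f ->
  smooth (fun z => f (stretch l z)).
Proof.
move=> sf s z.
pose D := fun (v : R * R) (g : R * R -> R) => 'D_v g.
have -> : foldr D (fun z => f (stretch l z)) s =
    fun z => foldr D f (map (stretch l) s) (stretch l z).
  elim: s => //= v s ->; apply/funext => w; exact: derive_stretch.
apply: differentiable_comp; first exact: differentiable_stretch.
exact: sf.
Qed.

Lemma derive_ex_stretch l (f : R * R -> R) z : smooth f ->
  'D_(e_x R) (fun w => f (stretch l w)) z = l * 'D_(e_x R) f (stretch l z).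
Proof.
move=> sf; rewrite derive_stretch.
have -> : stretch l (e_x R) = l *: (e_x R : R^o * R^o).
  by rewrite /stretch /e_x/=; congr pair; rewrite scaler0.
by rewrite !deriveE ?linearZ//; exact: smooth_differentiable.
Qed.

Lemma derive_ey_stretch l (f : R * R -> R) z :
  'D_(e_y R) (fun w => f (stretch l w)) z = 'D_(e_y R) f (stretch l z).
Proof. by rewrite derive_stretch /stretch /e_y/= mulr0. Qed.

Lemma stretchK l : l != 0 -> cancel (stretch l) (stretch l^-1).
Proof. by move=> l0 [x y]; rewrite /stretch/= mulKf. Qed.

Lemma stretchVK l : l != 0 -> cancel (stretch l^-1) (stretch l).
Proof. by move=> l0 [x y]; rewrite /stretch/= mulVKf. Qed.

Lemma preimage_stretch_triangle l q : 0 < l ->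
  stretch l @^-1` triangle q = triangle (q / l).
Proof.
move=> l0; apply/seteqP; split => -[x y]; rewrite /triangle /stretch/=;
  rewrite pmulr_rgt0// ltr_pdivlMr// [x * l]mulrC invf_div mulrCA mulrA//.
Qed.

(** The support of the new function is closed and contained in the image of a
    compact set under the inverse stretch. *)
Lemma test_function_stretch l (D : set (R * R)) phi : l != 0 ->
  test_function D phi ->
  test_function (stretch l @^-1` D) (fun z => phi (stretch l z)).
Proof.
move=> l0 [sphi cphi sub].
set K := closure _ in cphi sub.
have sK : closure [set z | phi (stretch l z) != 0] `<=` stretch l @^-1` K.
  have cK : closed (stretch l @^-1` K).
    apply: closed_comp; last exact: closed_closure.
    by move=> z _; exact: stretch_continuous.
  rewrite closureE => z; apply; split => // w pw.
  by apply: (@subset_closure _ [set z | phi z != 0]); exact: pw.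
split.
- exact: smooth_stretch.
- apply: (subclosed_compact (@closed_closure _ _) _ sK).
  rewrite (_ : _ @^-1` K = stretch l^-1 @` K).
    apply: continuous_compact => //.
    by apply: continuous_subspaceT; exact: stretch_continuous.
  apply/seteqP; split => [z Kz|_ [z Kz <-]].
    by exists (stretch l z) => //; rewrite stretchK.
  by rewrite /preimage/= stretchVK.
- by move=> z /sK /sub.
Qed.

(** Weak derivatives are transported by applying the definition on the
    original triangle to the test function moved back by the inverse stretch;
    the trace is unchanged since the stretch fixes the side AC pointwise. *)
Lemma H1_AC_stretch l q u ux uy : 0 < l -> H1_AC q u ux uy ->
  H1_AC (q / l) (fun z => u (stretch l z)) (fun z => l * ux (stretch l z))
    (fun z => uy (stretch l z)).
Proof.
move=> l0 [[Lu Lux Luy wx wy] [phi [sphi cu cux cuy cw]]].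
have lN0 : l != 0 by rewrite gt_eqF.
have mt := triangle_measurable q.
have mp := measurable_preimage_stretch l mt.
have cphi n := smooth_continuous (sphi n).
have mD v n : measurable_fun (triangle q) ('D_v (phi n)).
  apply: measurable_funTS; apply: continuous_measurable_plane.
  by apply: smooth_continuous; exact: smooth_derive.
rewrite /H1_AC /H1_grad /trace_AC -preimage_stretch_triangle//.
split; last first.
  exists (fun n z => phi n (stretch l z)); split.
  - by move=> n; exact: smooth_stretch.
  - apply: cvg_L2_stretch => //; last by case: Lu.
    by move=> n; apply: measurable_funTS; exact: continuous_measurable_plane.
  - rewrite (_ : (fun n => _) =
        fun n z => l * 'D_(e_x R) (phi n) (stretch l z)).
      have m1 n := measurable_fun_stretch (l := l) mt (mD (e_x R) n).
      have m2 := measurable_fun_stretch (l := l) mt (proj1 Lux).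
      have c1 := cvg_L2_stretch l0 mt (mD (e_x R)) (proj1 Lux) cux.
      exact (cvg_L2Z mp l m1 m2 c1).
    by apply/funext => n; apply/funext => z; rewrite derive_ex_stretch.
  - rewrite (_ : (fun n => _) = fun n z => 'D_(e_y R) (phi n) (stretch l z)).
      exact (cvg_L2_stretch l0 mt (mD (e_y R)) (proj1 Luy) cuy).
    by apply/funext => n; apply/funext => z; rewrite derive_ey_stretch.
  - by rewrite /stretch/= mulr0.
have testV psi : test_function (stretch l @^-1` triangle q) psi ->
    exists2 phi0, test_function (triangle q) phi0 &
      psi = fun z => phi0 (stretch l z).
  move=> tpsi; exists (fun z => psi (stretch l^-1 z)).
    have := test_function_stretch (invr_neq0 lN0) tpsi.
    rewrite (_ : _ @^-1` _ = triangle q)//.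
    by apply/seteqP; split => z; rewrite /preimage/= stretchVK.
  by apply/funext => z; rewrite stretchK.
have Lp (f : R * R -> R) : smooth f -> in_L2 leb2 (triangle q) f.
  by move=> sf; apply: continuous_in_L2_triangle; exact: smooth_continuous.
split.
- exact: in_L2_stretch.
- by apply: in_L2Z => //; exact: in_L2_stretch.
- exact: in_L2_stretch.
- move=> _ /testV[phi0 t0 ->]; have := wx _ t0; have [s0 _ _] := t0.
  have L0 := Lp _ s0; have L1 := Lp _ (smooth_derive (e_x R) s0).
  have I1 := in_L2_integrable_mul mt Lu L1.
  have I2 := in_L2_integrable_mul mt Lux L0.
  have I1s := integrable_stretch l0 mt I1.
  have I2s := integrable_stretch l0 mt I2.
  rewrite (Rintegral_stretch l0 mt I1) (Rintegral_stretch l0 mt I2).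
  rewrite -!RintegralZl// => E.
  under eq_Rintegral do rewrite derive_ex_stretch// mulrCA.
  by rewrite E; congr (- _); apply: eq_Rintegral => z _; rewrite mulrA.
- move=> _ /testV[phi0 t0 ->]; have := wy _ t0; have [s0 _ _] := t0.
  have L0 := Lp _ s0; have L1 := Lp _ (smooth_derive (e_y R) s0).
  have I1 := in_L2_integrable_mul mt Lu L1.
  have I2 := in_L2_integrable_mul mt Luy L0.
  rewrite (Rintegral_stretch l0 mt I1) (Rintegral_stretch l0 mt I2).
  rewrite -mulrN => /(mulfI lN0) E.
  by under eq_Rintegral do rewrite derive_ey_stretch.
Qed.

(** * Comparison of two triangles *)

Section Variation.
Variables (p q : R) (u ux uy v vx vy : R * R -> R).
Hypotheses (p0 : 0 < p) (q0 : 0 < q).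
Hypotheses (wu : weak_solution p u ux uy) (wv : weak_solution q v vx vy).
Local Notation l := (q / p).
Local Notation Tp := (\int[leb2]_(z in triangle p) u z).
Local Notation Tq := (\int[leb2]_(z in triangle q) v z).
Local Notation Ap := (\int[leb2]_(z in triangle p) (ux z ^+ 2)).
Local Notation Bp := (\int[leb2]_(z in triangle p) (uy z ^+ 2)).
Local Notation Aq := (\int[leb2]_(z in triangle q) (vx z ^+ 2)).
Local Notation Bq := (\int[leb2]_(z in triangle q) (vy z ^+ 2)).
(* In these mixed energies the derivatives of [v] are moved to the triangle of
   base [p] as they stand: the horizontal derivative of the moved function is
   [l] times the moved derivative. *)
Local Notation al :=
  (\int[leb2]_(z in triangle p) (ux z * vx (stretch l z))).
Local Notation be :=
  (\int[leb2]_(z in triangle p) (uy z * vy (stretch l z))).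

Let l0 : 0 < l. Proof. by rewrite divr_gt0. Qed.
Let mp : measurable (triangle p : set plane) := triangle_measurable p.
Let mq : measurable (triangle q : set plane) := triangle_measurable q.
Let qlp : q / l = p.
Proof. by rewrite invf_div mulrCA mulfV ?mulr1// gt_eqF. Qed.
Let plq : p / l^-1 = q.
Proof. by rewrite invrK mulrCA mulfV ?mulr1// gt_eqF. Qed.
Let pre : stretch l @^-1` triangle q = triangle p.
Proof. by rewrite preimage_stretch_triangle// qlp. Qed.

Let Hu : H1_AC p u ux uy. Proof. by case: wu. Qed.
Let Hv : H1_AC q v vx vy. Proof. by case: wv. Qed.
Let Lu : in_L2 leb2 (triangle p) u. Proof. by case: Hu => -[]. Qed.
Let Lux : in_L2 leb2 (triangle p) ux. Proof. by case: Hu => -[]. Qed.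
Let Luy : in_L2 leb2 (triangle p) uy. Proof. by case: Hu => -[]. Qed.
Let Lv : in_L2 leb2 (triangle q) v. Proof. by case: Hv => -[]. Qed.
Let Lvx : in_L2 leb2 (triangle q) vx. Proof. by case: Hv => -[]. Qed.
Let Lvy : in_L2 leb2 (triangle q) vy. Proof. by case: Hv => -[]. Qed.

Let LX : in_L2 leb2 (triangle p) (fun z => vx (stretch l z)).
Proof. by rewrite -pre; exact: in_L2_stretch. Qed.
Let LY : in_L2 leb2 (triangle p) (fun z => vy (stretch l z)).
Proof. by rewrite -pre; exact: in_L2_stretch. Qed.

(** The equation on the triangle of base [p], tested with [v] moved there. *)
Lemma cross_energy_q : l * al + be = Tq / l.
Proof.
have Hs := H1_AC_stretch l0 Hv; rewrite qlp in Hs.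
have := (proj2 wu) _ _ _ Hs.
rewrite (Rintegral_stretch l0 mq (in_L2_integrable_triangle Lv)) pre.
rewrite [l * _ / l]mulrAC mulfV ?gt_eqF// mul1r => <-.
rewrite -RintegralZl//; last exact: in_L2_integrable_mul.
rewrite -RintegralD//; last 2 first.
- by apply: integrable_EFinZ => //; exact: in_L2_integrable_mul.
- exact: in_L2_integrable_mul.
by apply: eq_Rintegral => z _; rewrite mulrCA.
Qed.

(** The equation on the triangle of base [q], tested with [u] moved there, and
    pulled back to the triangle of base [p]. *)
Lemma cross_energy_p : al / l + be = Tp.
Proof.
have l0' : 0 < l^-1 by rewrite invr_gt0.
have Hs := H1_AC_stretch l0' Hu; rewrite plq in Hs.
have LVX : in_L2 leb2 (triangle q) (fun z => l^-1 * ux (stretch l^-1 z)).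
  by case: Hs => -[].
have LVY : in_L2 leb2 (triangle q) (fun z => uy (stretch l^-1 z)).
  by case: Hs => -[].
have LV : in_L2 leb2 (triangle q) (fun z => u (stretch l^-1 z)).
  by case: Hs => -[].
have := (proj2 wv) _ _ _ Hs.
rewrite [LHS](Rintegral_stretch l0 mq); last first.
  by apply: integrable_EFinD => //; exact: in_L2_integrable_mul.
rewrite [RHS](Rintegral_stretch l0 mq (in_L2_integrable_triangle LV)) pre.
move=> /(mulfI (lt0r_neq0 l0)).
under [in RHS]eq_Rintegral do rewrite stretchK ?gt_eqF//.
move=> <-.
rewrite mulrC -RintegralZl//; last exact: in_L2_integrable_mul.
rewrite -RintegralD//; last 2 first.
- by apply: integrable_EFinZ => //; exact: in_L2_integrable_mul.
- exact: in_L2_integrable_mul.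
apply: eq_Rintegral => z _; rewrite stretchK ?gt_eqF//; ring.
Qed.

Let sqX : \int[leb2]_(z in triangle p) (vx (stretch l z) ^+ 2) = Aq / l.
Proof.
rewrite (Rintegral_stretch l0 mq (in_L2_integrable_sqr mq Lvx)) pre.
by rewrite [l * _ / l]mulrAC mulfV ?gt_eqF// mul1r.
Qed.

Let sqY : \int[leb2]_(z in triangle p) (vy (stretch l z) ^+ 2) = Bq / l.
Proof.
rewrite (Rintegral_stretch l0 mq (in_L2_integrable_sqr mq Lvy)) pre.
by rewrite [l * _ / l]mulrAC mulfV ?gt_eqF// mul1r.
Qed.

(** Eliminate [Tp] and [Tq] by means of the two crossed identities. *)
Lemma torsion_ratio_diff :
  Tp / p ^+ 2 - Tq / q ^+ 2 = (p - q) * ((al - be) / (q * p ^+ 2)).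
Proof.
have Tq' : Tq = l * (l * al + be).
  by rewrite cross_energy_q mulrCA mulfV ?mulr1// gt_eqF.
rewrite Tq' -cross_energy_p; field.
by rewrite !gt_eqF.
Qed.

(** Adding the squared distances of the horizontal and of the vertical
    derivatives, the energies combine by [energy_identity] and the crossed
    identities into [(p - q)^2 * al / (p * q)]. Each distance is at most this
    sum, and controls the difference between mixed and pure energy by
    [Rintegral_sqr_dist]. *)
Lemma cross_energy_bounds :
  [/\ (al - Aq / l) ^+ 2 <= (p - q) ^+ 2 * (al * Aq / q ^+ 2),
      (be - Bq / l) ^+ 2 <= (p - q) ^+ 2 * (al * Bq / q ^+ 2) &
      2 * al <= p ^+ 3 / 12 + Aq / l].
Proof.
have [] := Rintegral_sqr_dist mp Lux LX; rewrite sqX => X0 X1.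
have [] := Rintegral_sqr_dist mp Luy LY; rewrite sqY => Y0 Y1.
have Eu := energy_identity wu.
have Ev := energy_identity wv.
have Tb := torsion_le_cube p0 wu.
have Bp0 : 0 <= Bp by apply: Rintegral_ge0 => z _; exact: sqr_ge0.
have Aq0 : 0 <= Aq by apply: Rintegral_ge0 => z _; exact: sqr_ge0.
have Bq0 : 0 <= Bq by apply: Rintegral_ge0 => z _; exact: sqr_ge0.
have S : (Ap - 2 * al + Aq / l) + (Bp - 2 * be + Bq / l) =
    (p - q) ^+ 2 * (al / (p * q)).
  transitivity ((Ap + Bp) + (Aq + Bq) / l - 2 * (al + be)); first by ring.
  rewrite Eu Ev -cross_energy_q -cross_energy_p; field.
  by rewrite !gt_eqF.
split.
- apply: (le_trans X1).
  rewrite (_ : (p - q) ^+ 2 * _ = (p - q) ^+ 2 * (al / (p * q)) * (Aq / l)).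
    apply: ler_wpM2r; first by rewrite divr_ge0// ltW.
    by rewrite -S lerDl.
  by field; rewrite !gt_eqF.
- apply: (le_trans Y1).
  rewrite (_ : (p - q) ^+ 2 * _ = (p - q) ^+ 2 * (al / (p * q)) * (Bq / l)).
    apply: ler_wpM2r; first by rewrite divr_ge0// ltW.
    by rewrite -S lerDr.
  by field; rewrite !gt_eqF.
- move: X0; rewrite addrAC subr_ge0 => /le_trans; apply.
  by rewrite lerD2r; apply: le_trans Tb; rewrite -Eu lerDl.
Qed.

End Variation.

End Triangle.

(** * Differentiation of the torsion ratio *)

Section Limit.
Context {R : realType}.

Lemma cvg_lipschitz_at (f : R -> R) (q L K r : R) : 0 < r ->
  (forall p, `|p - q| < r -> `|f p - L| <= `|p - q| * K) ->
  f p @[p --> q] --> L.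
Proof.
move=> r0 fK; apply/cvgrPdist_lt => e e0.
have K1 : 0 < `|K| + 1 by rewrite ltr_wpDl.
near=> p.
have pr : `|p - q| < r.
  by rewrite distrC; near: p; exact: cvgr_dist_lt.
have pe : `|p - q| < e / (`|K| + 1).
  by rewrite distrC; near: p; apply: cvgr_dist_lt => //; rewrite divr_gt0.
rewrite distrC (le_lt_trans (fK p pr))//.
move: pe; rewrite ltr_pdivlMr//; apply: le_lt_trans.
by rewrite ler_wpM2l// (le_trans (ler_norm K))// lerDl.
Unshelve. all: by end_near. Qed.

Lemma sqr_le_lipschitz (x h k K : R) : x ^+ 2 <= h ^+ 2 * k -> k <= K ->
  0 <= K -> `|x| <= `|h| * (K + 1).
Proof.
move=> xh kK K0.
rewrite -(@ler_pXn2r _ 2)// ?nnegrE ?mulr_ge0// ?addr_ge0//.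
rewrite exprMn !real_normK ?num_real//.
apply: (le_trans xh); apply: ler_wpM2l; first exact: sqr_ge0.
nra.
Qed.

Lemma is_derive_quotient (F g : R -> R) (q d r : R) : 0 < r ->
  (forall p, `|p - q| < r -> F p - F q = (p - q) * g p) ->
  g p @[p --> q] --> d -> is_derive q 1 F d.
Proof.
move=> r0 Fg gd.
have shiftq : (fun h : R => h + q) h @[h --> 0^'] --> q.
  rewrite -[X in _ --> X]add0r.
  apply: cvg_within_filter.
  by apply: cvgD => //; exact: cvg_cst.
have H : (fun h : R => h^-1 *: ((F \o shift q) (h *: 1) - F q)) h
    @[h --> 0^'] --> d.
  have := cvg_comp _ _ shiftq gd; apply: cvg_trans.
  apply: near_eq_cvg; near=> h.
  have h0 : h != 0 by near: h; exact: nbhs_dnbhs_neq.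
  rewrite /= /GRing.scale/= mulr1 Fg addrK ?mulKf//.
  by near: h; exact: dnbhs0_lt.
apply: DeriveDef; first by apply/cvg_ex; exists d.
exact: (cvg_lim (@Rhausdorff R) H).
Unshelve. all: by end_near. Qed.

End Limit.

Section Torsion.
Context {R : realType}.
Variables (u ux uy : R -> R * R -> R).
Hypothesis hu : forall q : R, 0 < q -> weak_solution q (u q) (ux q) (uy q).
Let T (q : R) := \int[leb2]_(z in triangle q) u q z.
Let F (q : R) := T q / q ^+ 2.
Let A (q : R) := \int[leb2]_(z in triangle q) (ux q z) ^+ 2.
Let B (q : R) := \int[leb2]_(z in triangle q) (uy q z) ^+ 2.

(** By [torsion_ratio_diff] it suffices that the mixed energies converge to
    [A q] and [B q]. The last bound of [cross_energy_bounds] keeps [al]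
    bounded near [q], so the other two bounds are Lipschitz estimates. *)
Lemma is_derive_torsion_ratio (q : R) : 0 < q ->
  is_derive q 1 F ((A q - B q) / q ^+ 3).
Proof.
move=> q0.
pose al (p : R) :=
  \int[leb2]_(z in triangle p) (ux p z * ux q (stretch (q / p) z)).
pose be (p : R) :=
  \int[leb2]_(z in triangle p) (uy p z * uy q (stretch (q / p) z)).
have A0 : 0 <= A q by apply: Rintegral_ge0 => z _; exact: sqr_ge0.
have B0 : 0 <= B q by apply: Rintegral_ge0 => z _; exact: sqr_ge0.
pose M := q ^+ 3 + A q.
have q3 : 0 < q ^+ 3 by rewrite exprn_gt0.
have M0 : 0 <= M by rewrite /M addr_ge0// ltW.
have near_pos p : `|p - q| < q -> 0 < p /\ p < 2 * q.
  by rewrite ltr_norml => /andP[? ?]; lra.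
have alM p : 0 < p -> p < 2 * q -> al p <= M.
  move=> p0 p2q; have [_ _] := cross_energy_bounds p0 q0 (hu p0) (hu q0).
  rewrite -/(al p) -/(A q).
  have : p ^+ 3 <= (2 * q) ^+ 3 by rewrite lerXn2r// ?nnegrE; lra.
  have : A q / (q / p) <= A q * 2.
    rewrite ler_wpM2l// invf_div ler_pdivrMr//; lra.
  rewrite /M exprMn; lra.
have bound (c : R -> R) (C : R) : 0 <= C ->
    (forall p, 0 < p -> p < 2 * q ->
       (c p - C / (q / p)) ^+ 2 <= (p - q) ^+ 2 * (al p * C / q ^+ 2)) ->
    c p @[p --> q] --> C.
  move=> C0 cC.
  have c1 : c p - C / (q / p) @[p --> q] --> 0.
    apply: (@cvg_lipschitz_at _ _ _ _ (M * C / q ^+ 2 + 1) q) => // p.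
    move=> /near_pos[p0 p2q]; rewrite subr0.
    apply: sqr_le_lipschitz (cC _ p0 p2q) _ _.
      by rewrite ler_wpM2r ?invr_ge0 ?sqr_ge0// ler_wpM2r// alM.
    by rewrite divr_ge0 ?sqr_ge0// mulr_ge0.
  have c2 : C / (q / p) @[p --> q] --> C.
    rewrite [X in _ --> X](_ : C = C / (q / q)); last first.
      by rewrite mulfV ?gt_eqF// divr1.
    under eq_fun do rewrite invf_div.
    rewrite invf_div.
    have cp : (fun p : R => p) p @[p --> q] --> q by [].
    exact: cvgMr (cvgMl cp).
  have := cvgD c1 c2; rewrite add0r.
  rewrite (_ : _ + _ = c); first exact.
  by apply/funext => p; rewrite !fctE subrK.
have cal : al p @[p --> q] --> A q.
  apply: bound => // p p0 _.
  by have [] := cross_energy_bounds p0 q0 (hu p0) (hu q0).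
have cbe : be p @[p --> q] --> B q.
  apply: bound => // p p0 _.
  by have [] := cross_energy_bounds p0 q0 (hu p0) (hu q0).
apply: (@is_derive_quotient _ _ (fun p => (al p - be p) / (q * p ^+ 2))
  _ _ q) => //.
  move=> p /near_pos[p0 _].
  exact: (torsion_ratio_diff p0 q0 (hu p0) (hu q0)).
apply: cvgM; first exact: cvgB.
rewrite (_ : q ^+ 3 = q * q ^+ 2)//.
apply: cvgV; first by rewrite mulf_neq0// ?expf_neq0// gt_eqF.
apply: cvgMr; exact: exprn_continuous.
Qed.

Lemma torsion_ratio_derive_gt0 (q : R) : 0 < q -> 0 < (A q - B q) / q ^+ 3.
Proof.
move=> q0; rewrite divr_gt0 ?exprn_gt0// subr_gt0.
exact: (y_energy_lt_x_energy q0 (hu q0)).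
Qed.

Lemma torsion_ratio_increasing (p q : R) : 0 < p -> p < q -> F p < F q.
Proof.
move=> p0 pq.
have dF x : p <= x -> derivable F x 1.
  move=> px; have := is_derive_torsion_ratio (lt_le_trans p0 px); by case.
apply: (@gtr0_derive1_incr _ F p q) => //.
- by move=> x; rewrite in_itv/= => /andP[/ltW px _]; exact: dF.
- move=> x; rewrite in_itv/= => /andP[px _]; have x0 := lt_trans p0 px.
  rewrite derive1E; case: (is_derive_torsion_ratio x0) => _ ->.
  exact: torsion_ratio_derive_gt0.
- apply: derivable_within_continuous => x; rewrite in_itv/= => /andP[px _].
  exact: dF.
Qed.

End Torsion.

Theorem theorem1p1 (R : realType) (u ux uy : R -> R * R -> R)
    (hu : forall q : R, 0 < q -> weak_solution q (u q) (ux q) (uy q)) :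
  let T := fun q : R => \int[leb2]_(z in triangle q) u q z in
  let F := fun q : R => T q / q ^+ 2 in
  let A := fun q : R => \int[leb2]_(z in triangle q) (ux q z) ^+ 2 in
  let B := fun q : R => \int[leb2]_(z in triangle q) (uy q z) ^+ 2 in
  (forall p q : R, 0 < p -> p < q -> F p < F q) /\
  (forall q : R, 0 < q ->
     is_derive q 1 F ((A q - B q) / q ^+ 3) /\ 0 < (A q - B q) / q ^+ 3).
Proof.
move=> T F A B; split.
  by move=> p q p0 pq; exact (torsion_ratio_increasing hu p0 pq).
move=> q q0; split.
  exact (is_derive_torsion_ratio hu q0).
exact (torsion_ratio_derive_gt0 hu q0).
Qed.
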